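(* Let $k$ be an algebraically closed field of characteristic $0$, let $G$ be a finite graph with $n\ge 1$ edges, and fix $q\in k$, $q\ne 0$. Let $V\subset\mathbb{A}^n_k$ (with coordinates $t_e$ indexed by the edges $e$ of $G$) be the affine Potts model hypersurface, i.e. the zero set of $$Z_G(q,t)=\sum_{G'\subseteq G} q^{k(G')}\prod_{e\in E(G')}t_e .$$ Then in $K_0(\mathrm{Var}_k)$ one has $[V]\equiv 1\pmod{\mathbb{L}}$ if $n$ is odd and $[V]\equiv -1\pmod{\mathbb{L}}$ if $n$ is even.
   Context: In the sum, $G'$ ranges over the subgraphs of $G$ having the same vertex set as $G$ (equivalently, over all subsets of the edge set of $G$); $k(G')$ is the number of connected components of $G'$ and $E(G')$ is its set of edges. $K_0(\mathrm{Var}_k)$ is the Grothendieck ring of varieties over $k$: the abelian group generated by isomorphism classes $[X]$ of $k$-varieties (not necessarily irreducible), modulo $[X]=[Y]+[X\setminus Y]$ for every closed subvariety $Y\subseteq X$, with product $[X]\cdot[Y]=[X\times_k Y]$. $\mathbb{L}=[\mathbb{A}^1_k]$, and congruence modulo $\mathbb{L}$ means modulo the ideal $(\mathbb{L})$. Zero loci are considered as sets of zeros (reduced structure). *)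

(* Defs.v *)
From HB Require Import structures.
From mathcomp Require Import all_boot all_algebra.
From mathcomp Require Import mpoly.
From mathcomp Require Import boolp classical_sets.

Set Implicit Arguments.
Unset Strict Implicit.
Unset Printing Implicit Defensive.

Import GRing.Theory.
Local Open Scope classical_set_scope.
Local Open Scope ring_scope.

(* Varieties over an algebraically closed field k are taken in the sense of   *)
(* Serre: spaces with functions (a topological space with a sheaf of k-valued *)
(* functions) that are covered by finitely many open affine algebraic sets    *)
(* and are separated.  They need not be irreducible, and are reduced.         *)

Section Spaces.
Variable k : closedFieldType.

(* A section of the structure sheaf over an open set U is represented by a    *)
(* total function; only its values on U matter (see fs_ext below), and        *)
(* [reg U f] is meaningful only when U is open.                               *)
Record space := Space {
  point :> Type;
  opn : set (set point);
  reg : set point -> set (point -> k) }.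

Record is_fspace (X : space) : Prop := IsFspace {
  fs_setT : opn (@setT X);
  fs_setI (U V : set X) : opn U -> opn V -> opn (U `&` V);
  fs_bigcup (F : set (set X)) : F `<=` @opn X -> opn (\bigcup_(U in F) U);
  fs_ext (U : set X) (f g : X -> k) :
    opn U -> (forall x, U x -> f x = g x) -> reg U f -> reg U g;
  fs_restr (U V : set X) (f : X -> k) :
    opn U -> opn V -> V `<=` U -> reg U f -> reg V f;
  fs_glue (F : set (set X)) (f : X -> k) :
    (forall U, F U -> opn U /\ reg U f) -> reg (\bigcup_(U in F) U) f;
  fs_const (U : set X) (c : k) : opn U -> reg U (fun=> c);
  fs_add (U : set X) (f g : X -> k) :
    opn U -> reg U f -> reg U g -> reg U (fun x => f x + g x);
  fs_mul (U : set X) (f g : X -> k) :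
    opn U -> reg U f -> reg U g -> reg U (fun x => f x * g x);
  fs_inv (U : set X) (f : X -> k) : opn U -> reg U f ->
    opn (U `&` [set x | f x != 0]) /\
    reg (U `&` [set x | f x != 0]) (fun x => (f x)^-1) }.

Definition morphism (X Y : space) (f : X -> Y) : Prop :=
  forall V : set Y, opn V ->
    opn (f @^-1` V) /\
    forall h : Y -> k, reg V h -> reg (f @^-1` V) (fun x => h (f x)).

Definition isomorphic (X Y : space) : Prop :=
  exists (f : X -> Y) (g : Y -> X),
    [/\ morphism f, morphism g, cancel f g & cancel g f].

(* Induced structure on a subset A: the trace topology, and the functions     *)
(* that are locally restrictions of regular functions of X.                   *)
Definition subspace_of (X : space) (A : set X) : space :=
  @Space {x : X | A x}
    [set U | exists2 W : set X, opn W & U = [set x | W (sval x)]]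
    (fun U => [set f | forall x, U x ->
       exists (W : set X) (h : X -> k),
         [/\ opn W, W (sval x), reg W h &
             forall y, U y -> W (sval y) -> f y = h (sval y)]]).

(* The zero set of S in k^n with the Zariski topology; regular functions are  *)
(* the functions that are locally quotients of polynomials.                   *)
Definition peval n (x : 'rV[k]_n) (f : {mpoly k[n]}) : k := f.@[x ord0].

Definition zero_set n (S : set {mpoly k[n]}) : set 'rV[k]_n :=
  [set x | forall f, S f -> peval x f = 0].

Definition aff_open n (S : set {mpoly k[n]}) : set (set {x | zero_set S x}) :=
  [set U | exists T : set {mpoly k[n]},
      U = [set x | exists2 f, T f & peval (sval x) f != 0]].

Definition aff n (S : set {mpoly k[n]}) : space :=
  @Space {x | zero_set S x} (@aff_open n S)
    (fun U => [set f | forall x, U x ->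
       exists (W : set {x | zero_set S x}) (g h : {mpoly k[n]}),
         [/\ aff_open W, W x, W `<=` U &
             forall y, W y -> peval (sval y) h != 0 /\
                       f y = peval (sval y) g / peval (sval y) h]]).

Definition is_affine (X : space) : Prop :=
  exists (n : nat) (S : set {mpoly k[n]}), isomorphic X (aff S).

Definition is_prevariety (X : space) : Prop :=
  is_fspace X /\
  exists (I : finType) (U : I -> set X),
    [/\ forall i, opn (U i),
        forall x, exists i, U i x &
        forall i, is_affine (subspace_of (U i))].

(* X is separated iff any two morphisms to X agree on a closed subset.        *)
Definition is_separated (X : space) : Prop :=
  forall (Z : space) (f g : Z -> X), is_prevariety Z ->
    morphism f -> morphism g -> opn (~` [set z | f z = g z]).

(* X x Y: the topology has as a basis the sets of the points (x, y) of U x V  *)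
(* with sum_i a_i(x) b_i(y) != 0, for a_i regular on U and b_i regular on V;  *)
(* regular functions are locally quotients of such sums.                      *)
Section Product.
Variables X Y : space.

Definition tensor_fun (U : set X) (V : set Y) (F : X * Y -> k) : Prop :=
  exists (N : nat) (a : 'I_N -> X -> k) (b : 'I_N -> Y -> k),
    [/\ forall i, reg U (a i), forall i, reg V (b i) &
        forall p, F p = \sum_(i < N) a i p.1 * b i p.2].

Definition prod_open : set (set (X * Y)) :=
  [set W | forall p, W p -> exists (U : set X) (V : set Y) (F : X * Y -> k),
    [/\ opn U /\ opn V, U p.1 /\ V p.2, tensor_fun U V F, F p != 0 &
        forall q, U q.1 -> V q.2 -> F q != 0 -> W q]].

Definition prod_reg (W : set (X * Y)) : set (X * Y -> k) :=
  [set f | forall p, W p ->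
    exists (W' : set (X * Y)) (U : set X) (V : set Y) (F G : X * Y -> k),
      [/\ prod_open W' /\ W' p, W' `<=` W,
          [/\ opn U, opn V & forall q, W' q -> U q.1 /\ V q.2],
          tensor_fun U V F /\ tensor_fun U V G &
          forall q, W' q -> G q != 0 /\ f q = F q / G q]].

Definition prod_space : space := @Space (X * Y)%type prod_open prod_reg.

End Product.

Record variety := Variety {
  vspace :> space;
  variety_prevariety : is_prevariety vspace;
  variety_separated : is_separated vspace }.

Lemma sval_inj (T : Type) (P : T -> Prop) (x y : {x | P x}) :
  sval x = sval y -> x = y.
Proof.
case: x y => x Px [y Py] /= exy; case: y / exy Py => Py.
by congr exist; exact: Prop_irrelevance.
Qed.

Lemma opn_loc (X : space) (U : set X) : is_fspace X ->
  (forall x, U x -> exists W, [/\ opn W, W x & W `<=` U]) -> opn U.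
Proof.
move=> hX hU.
have -> : U = \bigcup_(W in [set W | opn W /\ W `<=` U]) W.
  apply/seteqP; split=> [x Ux|x [W [_ sWU] Wx]]; last exact: sWU.
  by have [W [oW Wx sWU]] := hU x Ux; exists W.
by apply: fs_bigcup => // W [].
Qed.

Lemma reg_loc (X : space) (U : set X) (f : X -> k) : is_fspace X ->
  (forall x, U x -> exists W, [/\ opn W, W x, W `<=` U & reg W f]) -> reg U f.
Proof.
move=> hX hU.
have -> : U = \bigcup_(W in [set W | [/\ opn W, W `<=` U & reg W f]]) W.
  apply/seteqP; split=> [x Ux|x [W [_ sWU _] Wx]]; last exact: sWU.
  by have [W [oW Wx sWU rW]] := hU x Ux; exists W.
by apply: fs_glue => // W [].
Qed.

Lemma reg_sum (X : space) (U : set X) N (a : 'I_N -> X -> k) : is_fspace X ->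
  opn U -> (forall i, reg U (a i)) -> reg U (fun x => \sum_(i < N) a i x).
Proof.
move=> hX oU; elim: N a => [|N IH] a ra.
  by apply: fs_ext (fs_const hX 0 oU) => // x _; rewrite big_ord0.
have := fs_add hX oU (IH (fun i => a (widen_ord (leqnSn N) i)) (fun i => ra _))
          (ra ord_max).
by apply: fs_ext => // x _; rewrite big_ord_recr.
Qed.


Lemma reg_peval (X : space) (U : set X) n (r : X -> 'rV[k]_n)
    (f : {mpoly k[n]}) : is_fspace X -> opn U ->
  (forall i, reg U (fun x => r x ord0 i)) -> reg U (fun x => peval (r x) f).
Proof.
move=> hX oU hr; elim/mpolyind: f => [|c m p _ _ IH].
  by apply: fs_ext (fs_const hX 0 oU) => // x _; rewrite /peval meval0.
have hX1 (g : 'I_n -> X -> k) (s : seq 'I_n) : (forall i, reg U (g i)) ->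
    reg U (fun x => \prod_(i <- s) g i x).
  move=> rg; elim: s => [|i s IHs].
    by apply: fs_ext (fs_const hX 1 oU) => // x _; rewrite big_nil.
  by apply: fs_ext (fs_mul hX oU (rg i) IHs) => // x _; rewrite big_cons.
have hXm : reg U (fun x => \prod_(i < n) r x ord0 i ^+ m i).
  apply: hX1 => i; elim: (m i) => [|d IHd].
    by apply: fs_ext (fs_const hX 1 oU) => // x _; rewrite expr0.
  by apply: fs_ext (fs_mul hX oU (hr i) IHd) => // x _; rewrite exprS.
apply: fs_ext (fs_add hX oU (fs_mul hX oU (fs_const hX c oU) hXm) IH) => //.
by move=> x _; rewrite /peval mevalD mevalZ mevalX.
Qed.

Lemma morphism_comp (X Y Z : space) (f : X -> Y) (g : Y -> Z) :
  morphism f -> morphism g -> morphism (fun x => g (f x)).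
Proof.
move=> hf hg V oV; have [oV' rV'] := hg V oV; have [oV'' rV''] := hf _ oV'.
by split=> // h rh; apply: rV'' (rV' _ rh).
Qed.

Lemma isomorphic_refl (X : space) : isomorphic X X.
Proof. by exists id, id; split=> // V oV; split. Qed.

Lemma sub_opnP (X : space) (A : set X) (U : set (subspace_of A)) :
  is_fspace X ->
  (forall x, U x -> exists W : set X,
    [/\ opn W, W (sval x) & forall y, W (sval y) -> U y]) -> opn U.
Proof.
move=> hX hU.
pose F := [set W : set X | opn W /\ forall y : {x | A x}, W (sval y) -> U y].
exists (\bigcup_(W in F) W); first by apply: fs_bigcup => // W [].
apply/seteqP; split=> [x Ux|x [W [_ sW] Wx]]; last exact: sW.
by have [W [oW Wx sW]] := hU x Ux; exists W.
Qed.

Lemma sub_fspace (X : space) (A : set X) : is_fspace X ->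
  is_fspace (subspace_of A).
Proof.
move=> hX; split.
- by exists setT; [exact: fs_setT |].
- move=> _ _ [U oU ->] [V oV ->]; exists (U `&` V); first exact: fs_setI.
  by [].
- move=> F hF; apply: sub_opnP => // x [U FU Ux].
  have [W oW UW] := hF U FU; exists W; split=> //.
    by move: Ux; rewrite UW.
  by move=> y Wy; exists U => //; rewrite UW.
- move=> U f g oU fg rf x Ux; have [W [h [oW Wx rh hf]]] := rf x Ux.
  by exists W, h; split=> // y Uy Wy; rewrite -fg // hf.
- move=> U V f oU oV sVU rf x Vx; have [W [h [oW Wx rh hf]]] := rf x (sVU _ Vx).
  by exists W, h; split=> // y Vy Wy; apply: hf => //; exact: sVU.
- move=> F f hF x [U FU Ux]; have [[W' oW' UW'] rf] := hF U FU.
  have [W [h [oW Wx rh hf]]] := rf x Ux.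
  have oWW : opn (W `&` W') by exact: fs_setI.
  exists (W `&` W'), h; split=> //.
  + by split=> //; move: Ux; rewrite UW'.
  + by apply: fs_restr rh => // y [].
  + by move=> y _ [Wy W'y]; apply: hf => //; rewrite UW'.
- move=> U c oU x Ux; exists setT, (fun=> c); have oT := fs_setT hX.
  by split=> //; exact: fs_const.
- move=> U f g oU rf rg x Ux; have [W [h [oW Wx rh hf]]] := rf x Ux.
  have [W' [h' [oW' Wx' rh' hf']]] := rg x Ux.
  have oWW : opn (W `&` W') by exact: fs_setI.
  exists (W `&` W'), (fun x => h x + h' x); split=> //.
  + by apply: fs_add => //; [apply: fs_restr rh|apply: fs_restr rh'] => // y [].
  + by move=> y Uy [Wy Wy']; rewrite hf // hf'.
- move=> U f g oU rf rg x Ux; have [W [h [oW Wx rh hf]]] := rf x Ux.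
  have [W' [h' [oW' Wx' rh' hf']]] := rg x Ux.
  have oWW : opn (W `&` W') by exact: fs_setI.
  exists (W `&` W'), (fun x => h x * h' x); split=> //.
  + by apply: fs_mul => //; [apply: fs_restr rh|apply: fs_restr rh'] => // y [].
  + by move=> y Uy [Wy Wy']; rewrite hf // hf'.
- move=> U f [WU oWU eU] rf; split.
    apply: sub_opnP => // x [Ux fx]; have [W [h [oW Wx rh hf]]] := rf x Ux.
    have [oWh _] := fs_inv hX oW rh.
    exists (W `&` [set x | h x != 0] `&` WU); split; first exact: fs_setI.
      by split; [split=> //=; rewrite -hf|move: Ux; rewrite eU].
    move=> y [[Wy /= hy] WUy]; have Uy : U y by rewrite eU.
    by split=> //=; rewrite hf.
  move=> x [Ux fx]; have [W [h [oW Wx rh hf]]] := rf x Ux.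
  have [oWh rWh] := fs_inv hX oW rh.
  exists (W `&` [set x | h x != 0]), (fun x => (h x)^-1); split=> //.
    by split=> //=; rewrite -hf.
  by move=> y [Uy _] [Wy _]; rewrite hf.
Qed.

Lemma sub_incl (X : space) (A : set X) :
  @morphism (subspace_of A) X (fun x => sval x).
Proof.
move=> V oV; split; first by exists V.
by move=> h rh x Vx; exists V, h.
Qed.

Lemma sub_lift (Z X : space) (A : set X) (f : Z -> subspace_of A) :
  is_fspace Z -> is_fspace X -> morphism (fun z => sval (f z) : X) ->
  morphism f.
Proof.
move=> hZ hX hf V oV; have oU : opn (f @^-1` V).
  by case: oV => W oW ->; exact: (hf W oW).1.
split=> // h rh; apply: reg_loc => // z Vz.
have [W [h' [oW Wz rh' hh]]] := rh _ Vz.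
have [oW' rW'] := hf W oW.
have oI := fs_setI hZ oU oW'.
exists (f @^-1` V `&` (fun z => sval (f z)) @^-1` W); split=> //.
have sI : f @^-1` V `&` (fun z => sval (f z)) @^-1` W `<=`
  (fun z => sval (f z)) @^-1` W by move=> y [].
apply: fs_ext (fs_restr hZ oW' oI sI (rW' _ rh')) => // y [Vy Wy] /=.
by rewrite hh.
Qed.

Lemma sub_setT_iso (X : space) : is_fspace X ->
  isomorphic (subspace_of (@setT X)) X.
Proof.
move=> hX; exists (fun x => sval x), (fun x => exist _ x I); split.
- exact: sub_incl.
- by apply: sub_lift => // V oV; split.
- by case=> x [].
- by [].
Qed.

Lemma aff_openP n (S : set {mpoly k[n]}) (U : set (aff S)) :
  opn U <-> forall x, U x -> exists2 f, peval (sval x) f != 0 &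
    forall y : aff S, peval (sval y) f != 0 -> U y.
Proof.
split=> [[T ->] x [f Tf fx]|hU]; first by exists f => // y fy; exists f.
exists [set f | forall y : aff S, peval (sval y) f != 0 -> U y].
apply/seteqP; split=> [x Ux|x [f sf fx]]; last exact: sf.
by have [f fx sf] := hU x Ux; exists f.
Qed.

Lemma aff_opnI n (S : set {mpoly k[n]}) (U V : set (aff S)) :
  opn U -> opn V -> opn (U `&` V).
Proof.
move=> /aff_openP oU /aff_openP oV; apply/aff_openP => x [Ux Vx].
have [f fx sf] := oU x Ux; have [g gx sg] := oV x Vx.
exists (f * g) => [|y]; rewrite /peval mevalM mulf_eq0 negb_or ?fx //.
by case/andP=> fy gy; split; [exact: sf|exact: sg].
Qed.

Lemma aff_opnD n (S : set {mpoly k[n]}) (g : {mpoly k[n]}) :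
  @opn (aff S) [set x : aff S | peval (sval x) g != 0].
Proof. by apply/aff_openP => x gx; exists g. Qed.

Lemma aff_fspace n (S : set {mpoly k[n]}) : is_fspace (aff S).
Proof.
have oT : @opn (aff S) setT.
  by apply/aff_openP => x _; exists 1 => //; rewrite /peval meval1 oner_eq0.
split=> //.
- exact: aff_opnI.
- move=> F hF; apply/aff_openP => x [U FU Ux].
  have /aff_openP oU := hF U FU; have [f fx sf] := oU x Ux.
  by exists f => // y fy; exists U => //; exact: sf.
- move=> U f g oU fg rf x Ux; have [W [a [b [oW Wx sW hf]]]] := rf x Ux.
  by exists W, a, b; split=> // y Wy; have [? <-] := hf y Wy; rewrite fg //; apply: sW.
- move=> U V f oU oV sVU rf x Vx.
  have [W [a [b [oW Wx sW hf]]]] := rf x (sVU _ Vx).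
  exists (W `&` V), a, b; split=> //; [exact: aff_opnI|].
  by move=> y [Wy _]; exact: hf.
- move=> F f hF x [U FU Ux]; have [oU rf] := hF U FU.
  have [W [a [b [oW Wx sW hf]]]] := rf x Ux.
  by exists W, a, b; split=> // y Wy; exists U => //; exact: sW.
- move=> U c oU x Ux; exists U, c%:MP, 1; split=> // y _.
  by rewrite /peval mevalC meval1 oner_eq0 divr1.
- move=> U f g oU rf rg x Ux; have [W [a [b [oW Wx sW hf]]]] := rf x Ux.
  have [W' [a' [b' [oW' Wx' sW' hf']]]] := rg x Ux.
  exists (W `&` W'), (a * b' + a' * b), (b * b'); split=> //.
  + exact: aff_opnI.
  + by move=> y [Wy _]; exact: sW.
  + move=> y [/hf[b0 ->] /hf'[b0' ->]].
    by rewrite /peval mevalD !mevalM mulf_neq0 // addf_div.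
- move=> U f g oU rf rg x Ux; have [W [a [b [oW Wx sW hf]]]] := rf x Ux.
  have [W' [a' [b' [oW' Wx' sW' hf']]]] := rg x Ux.
  exists (W `&` W'), (a * a'), (b * b'); split=> //.
  + exact: aff_opnI.
  + by move=> y [Wy _]; exact: sW.
  + move=> y [/hf[b0 ->] /hf'[b0' ->]].
    by rewrite /peval !mevalM mulf_neq0 // mulf_div.
- move=> U f oU rf.
  have loc x : (U `&` [set x | f x != 0]) x ->
      exists (W : set (aff S)) (g h : {mpoly k[n]}),
      [/\ opn W, W x, W `<=` U `&` [set x | f x != 0] &
          forall y, W y -> peval (sval y) h != 0 /\
                    (f y)^-1 = peval (sval y) g / peval (sval y) h].
    move=> [Ux fx]; have [W [a [b [oW Wx sW hf]]]] := rf x Ux.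
    exists (W `&` [set x : aff S | peval (sval x) a != 0]), b, a; split.
    + by apply: aff_opnI => //; exact: aff_opnD.
    + split=> //=; have [b0 fE] := hf x Wx; move: fx; rewrite /= fE.
      by apply: contraNneq => ->; rewrite mul0r.
    + move=> y [Wy /= ay]; have [b0 fE] := hf y Wy; split; first exact: sW.
      by rewrite /= fE mulf_neq0 ?invr_neq0.
    + by move=> y [Wy /= ay]; have [b0 ->] := hf y Wy; rewrite invf_div.
  split=> //; apply/aff_openP => x /loc[W [g [h [/aff_openP oW Wx sW _]]]].
  by have [p px sp] := oW x Wx; exists p => // y py; exact/sW/sp.
Qed.

Lemma aff_coord n (S : set {mpoly k[n]}) (i : 'I_n) :
  @reg (aff S) setT (fun x => sval x ord0 i).
Proof.
move=> x _; exists setT, 'X_i, 1; split=> //.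
  exact: fs_setT (aff_fspace S).
by move=> y _; rewrite /peval mevalXU meval1 oner_eq0 divr1.
Qed.

Lemma aff_lift (Z : space) n (S : set {mpoly k[n]}) (f : Z -> aff S) :
  is_fspace Z -> (forall i, reg setT (fun z => sval (f z) ord0 i)) ->
  morphism f.
Proof.
move=> hZ hf; have oT := fs_setT hZ.
have rp (U : set Z) p : opn U -> reg U (fun z => peval (sval (f z)) p).
  by move=> oU; apply: reg_peval => // i; apply: fs_restr (hf i).
have oD p : opn [set z | peval (sval (f z)) p != 0].
  by have [+ _] := fs_inv hZ oT (rp _ p oT); rewrite setTI.
have oV V : opn V -> opn (f @^-1` V).
  move=> /aff_openP hV; apply: opn_loc => // z Vz.
  have [p pz sp] := hV _ Vz; exists [set z | peval (sval (f z)) p != 0].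
  by split=> // y; exact: sp.
move=> V hV; split=> [|h rh]; first exact: oV.
apply: reg_loc => // z Vz; have [W [a [b [/oV oW Wx sW hE]]]] := rh _ Vz.
exists (f @^-1` W); split=> //; first by move=> y Wy; exact: sW.
have [oI rI] := fs_inv hZ oW (rp _ b oW).
have WE : f @^-1` W `&` [set z | peval (sval (f z)) b != 0] = f @^-1` W.
  by apply/seteqP; split=> [y []//|y Wy]; split=> //; exact: (hE _ Wy).1.
rewrite WE in rI; apply: fs_ext (fs_mul hZ oW (rp _ a oW) rI) => //.
by move=> y Wy; rewrite (hE _ Wy).2.
Qed.

Lemma aff_prevariety n (S : set {mpoly k[n]}) : is_prevariety (aff S).
Proof.
have hS := aff_fspace S; split=> //; exists unit, (fun=> setT); split.
- by move=> _; exact: fs_setT.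
- by move=> x; exists tt.
- by move=> _; exists n, S; exact: sub_setT_iso.
Qed.

Lemma aff_separated n (S : set {mpoly k[n]}) : is_separated (aff S).
Proof.
move=> Z f g [hZ _] hf hg; have oT := fs_setT hZ.
apply: opn_loc => // z /= fgz.
have [i fgi] : exists i, sval (f z) ord0 i != sval (g z) ord0 i.
  apply: contrapT => /forallNP E; apply: fgz; apply: sval_inj.
  by apply/rowP => i; have /negP := E i; rewrite negbK => /eqP.
have oS := fs_setT (aff_fspace S).
have rc := @aff_coord n S i.
have rf := (hf _ oS).2 _ rc; have rg := (hg _ oS).2 _ rc.
have rd := fs_add hZ oT rf (fs_mul hZ oT (fs_const hZ (-1) oT) rg).
have [oI _] := fs_inv hZ oT rd.
eexists; split; [exact: oI| |].
  by split=> //=; rewrite mulN1r subr_eq0.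
by move=> y [_ /=]; rewrite mulN1r subr_eq0 => /eqP + E; rewrite E.
Qed.

Definition aff_variety n (S : set {mpoly k[n]}) : variety :=
  Variety (@aff_prevariety n S) (@aff_separated n S).

Section ProductTheory.
Variables X Y : space.
Hypotheses (hX : is_fspace X) (hY : is_fspace Y).

Lemma tensor_restr (U U' : set X) (V V' : set Y) F :
  opn U -> opn V -> opn U' -> opn V' -> U' `<=` U -> V' `<=` V ->
  tensor_fun U V F -> tensor_fun U' V' F.
Proof.
move=> oU oV oU' oV' sU sV [N [a [b [ra rb FE]]]]; exists N, a, b; split=> // i.
  exact: fs_restr (ra i).
exact: fs_restr (rb i).
Qed.

Lemma tensor_pure (U : set X) (V : set Y) a b :
  reg U a -> reg V b -> tensor_fun U V (fun p => a p.1 * b p.2).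
Proof.
by move=> ra rb; exists 1%N, (fun=> a), (fun=> b); split=> // p; rewrite big_ord1.
Qed.

Lemma tensor_add (U : set X) (V : set Y) F G :
  tensor_fun U V F -> tensor_fun U V G -> tensor_fun U V (fun p => F p + G p).
Proof.
move=> [N [a [b [ra rb FE]]]] [M [c [d [rc rd GE]]]].
exists (N + M)%N, (fun i => match split i with inl j => a j | inr j => c j end),
  (fun i => match split i with inl j => b j | inr j => d j end); split.
- by move=> i; case: split.
- by move=> i; case: split.
- move=> p; rewrite FE GE big_split_ord /=; congr (_ + _); apply: eq_bigr => i _.
    by rewrite (unsplitK (inl i)).
  by rewrite (unsplitK (inr i)).
Qed.

Lemma tensor_mul (U : set X) (V : set Y) F G : opn U -> opn V ->
  tensor_fun U V F -> tensor_fun U V G -> tensor_fun U V (fun p => F p * G p).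
Proof.
move=> oU oV [N [a [b [ra rb FE]]]] [M [c [d [rc rd GE]]]].
have -> : (fun p => F p * G p) = (fun p => \sum_(j < M) \sum_(i < N)
    (a i p.1 * c j p.1) * (b i p.2 * d j p.2)).
  apply: funext => p; rewrite FE GE mulr_sumr; apply: eq_bigr => j _.
  by rewrite mulr_suml; apply: eq_bigr => i _; rewrite mulrACA.
have tsum n (H : 'I_n -> X * Y -> k) : (forall i, tensor_fun U V (H i)) ->
    tensor_fun U V (fun p => \sum_(i < n) H i p).
  elim: n H => [|n IH] H tH.
    exists 0%N, (fun _ _ => 0), (fun _ _ => 0); split; try by case.
    by move=> p; rewrite !big_ord0.
  have := tensor_add (IH (fun i => H (widen_ord (leqnSn n) i)) (fun i => tH _))
            (tH ord_max).
  by congr tensor_fun; apply: funext => p; rewrite big_ord_recr.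
apply: (tsum M (fun j p => \sum_(i < N) _)) => j.
apply: (tsum N (fun i p => _)) => i.
apply: (@tensor_pure U V (fun x => a i x * c j x) (fun y => b i y * d j y)).
  exact: fs_mul.
exact: fs_mul.
Qed.

Lemma tensor_const (U : set X) (V : set Y) c : opn U -> opn V ->
  tensor_fun U V (fun=> c).
Proof.
move=> oU oV; have := tensor_pure (fs_const hX c oU) (fs_const hY 1 oV).
by congr tensor_fun; apply: funext => p; rewrite mulr1.
Qed.

Lemma prod_opnI (W W' : set (X * Y)) :
  prod_open W -> prod_open W' -> prod_open (W `&` W').
Proof.
move=> oW oW' p [Wp W'p].
have [U [V [F [[oU oV] [Up Vp] tF Fp sF]]]] := oW p Wp.
have [U' [V' [F' [[oU' oV'] [Up' Vp'] tF' Fp' sF']]]] := oW' p W'p.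
have oUU := fs_setI hX oU oU'; have oVV := fs_setI hY oV oV'.
exists (U `&` U'), (V `&` V'), (fun p => F p * F' p); split=> //.
- apply: tensor_mul => //; [apply: tensor_restr tF|apply: tensor_restr tF'];
    by move=> // y [].
- by rewrite mulf_neq0.
- move=> q [Uq Uq'] [Vq Vq']; rewrite mulf_eq0 negb_or => /andP[Fq Fq'].
  by split; [exact: sF|exact: sF'].
Qed.

Lemma prod_fspace : is_fspace (prod_space X Y).
Proof.
have oTX := fs_setT hX; have oTY := fs_setT hY.
have oT : prod_open (@setT (X * Y)).
  move=> p _; exists setT, setT, (fun=> 1); split=> //; last exact: oner_neq0.
  exact: tensor_const.
have meet (W : set (X * Y)) p f g : prod_reg W f -> prod_reg W g -> W p ->
  exists W' U V F G F' G', [/\ prod_open W' /\ W' p, W' `<=` W,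
    [/\ opn U, opn V & forall q, W' q -> U q.1 /\ V q.2],
    [/\ tensor_fun U V F, tensor_fun U V G, tensor_fun U V F'
      & tensor_fun U V G'] &
    forall q, W' q -> [/\ G q != 0, f q = F q / G q, G' q != 0 &
      g q = F' q / G' q]].
  move=> rf rg Wp.
  have [W1 [U [V [F [G [[oW1 W1p] sW1 [oU oV sUV] [tF tG] fE]]]]]] := rf p Wp.
  have [W2 [U' [V' [F' [G' [[oW2 W2p] _ [oU' oV' sUV'] [tF' tG'] gE]]]]]] :=
    rg p Wp.
  have oUU := fs_setI hX oU oU'; have oVV := fs_setI hY oV oV'.
  have sU1 : U `&` U' `<=` U by move=> x [].
  have sU2 : U `&` U' `<=` U' by move=> x [].
  have sV1 : V `&` V' `<=` V by move=> x [].
  have sV2 : V `&` V' `<=` V' by move=> x [].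
  exists (W1 `&` W2), (U `&` U'), (V `&` V'), F, G, F', G'; split.
  - by split=> //; exact: prod_opnI.
  - by move=> q [W1q _]; exact: sW1.
  - split=> // q [/sUV[Uq Vq] /sUV'[Uq' Vq']].
    by split.
  - split; [exact: tensor_restr tF|exact: tensor_restr tG
      |exact: tensor_restr tF'|exact: tensor_restr tG'].
  - by move=> q [/fE[G0 ->] /gE[G0' ->]].
split=> //.
- exact: prod_opnI.
- move=> S hS p [W SW Wp].
  have [U [V [F [oUV UVp tF Fp sF]]]] := hS W SW p Wp.
  exists U, V, F; split=> // q Uq Vq Fq; exists W => //; exact: sF.
- move=> W f g oW fg rf p Wp.
  have [W' [U [V [F [G [oW' sW' hUV tFG fE]]]]]] := rf p Wp.
  exists W', U, V, F, G; split=> // q W'q.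
  by have [G0 <-] := fE q W'q; rewrite fg //; exact: sW'.
- move=> W W2 f oW oW2 sW2 rf p Wp.
  have [W' [U [V [F [G [[oW' W'p] sW' [oU oV sUV] tFG fE]]]]]] := rf p (sW2 _ Wp).
  exists (W' `&` W2), U, V, F, G; split=> //.
  + by split=> //; exact: prod_opnI.
  + by split=> // q [W'q _]; exact: sUV.
  + by move=> q [W'q _]; exact: fE.
- move=> S f hS p [W SW Wp]; have [oW rf] := hS W SW.
  have [W' [U [V [F [G [oW' sW' hUV tFG fE]]]]]] := rf p Wp.
  by exists W', U, V, F, G; split=> // q W'q; exists W => //; exact: sW'.
- move=> W c oW p Wp; exists W, setT, setT, (fun=> c), (fun=> 1); split=> //.
  + by split; exact: tensor_const.
  + by move=> q _; rewrite oner_neq0 divr1.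
- move=> W f g oW rf rg p Wp.
  have [W' [U [V [F [G [F' [G' [oW' sW' [oU oV sUV] [tF tG tF' tG'] hE]]]]]]]] :=
    meet _ _ _ _ rf rg Wp.
  exists W', U, V, (fun q => F q * G' q + F' q * G q), (fun q => G q * G' q).
  split=> //.
  + by split; [apply: tensor_add|]; exact: tensor_mul.
  + by move=> q /hE[G0 -> G0' ->]; rewrite mulf_neq0 // addf_div.
- move=> W f g oW rf rg p Wp.
  have [W' [U [V [F [G [F' [G' [oW' sW' [oU oV sUV] [tF tG tF' tG'] hE]]]]]]]] :=
    meet _ _ _ _ rf rg Wp.
  exists W', U, V, (fun q => F q * F' q), (fun q => G q * G' q); split=> //.
  + by split; exact: tensor_mul.
  + by move=> q /hE[G0 -> G0' ->]; rewrite mulf_neq0 // mulf_div.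
- move=> W f oW rf.
  have oD : prod_open (W `&` [set p | f p != 0]).
    move=> p [Wp /= fp].
    have [W' [U [V [F [G [[oW' W'p] sW' [oU oV sUV] [tF tG] fE]]]]]] := rf p Wp.
    have [U' [V' [H [[oU' oV'] [Up' Vp'] tH Hp sH]]]] := oW' p W'p.
    have [Up Vp] := sUV _ W'p.
    have oUU := fs_setI hX oU oU'; have oVV := fs_setI hY oV oV'.
    exists (U `&` U'), (V `&` V'), (fun p => F p * H p); split=> //.
    + by apply: tensor_mul => //; [apply: tensor_restr tF|apply: tensor_restr tH];
        move=> // y [].
    + rewrite mulf_neq0 //; have [G0 fpE] := fE p W'p.
      by apply: contraNneq fp => F0; rewrite fpE F0 mul0r.
    + move=> q [Uq Uq'] [Vq Vq']; rewrite mulf_eq0 negb_or => /andP[Fq Hq].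
      have W'q := sH _ Uq' Vq' Hq; split; first exact: sW'.
      by have [G0 /= ->] := fE q W'q; rewrite mulf_neq0 ?invr_neq0.
  split=> // p [Wp /= fp].
  have [W' [U [V [F [G [[oW' W'p] sW' [oU oV sUV] [tF tG] fE]]]]]] := rf p Wp.
  exists (W' `&` (W `&` [set p | f p != 0])), U, V, G, F; split=> //.
  + by split; [exact: prod_opnI|split].
  + by split=> // q [W'q _]; exact: sUV.
  + move=> q [W'q [_ /= fq]]; have [G0 fE'] := fE q W'q; split.
      by apply: contraNneq fq => F0; rewrite fE' F0 mul0r.
    by rewrite fE' invf_div.
Qed.

Lemma prod_fst : @morphism (prod_space X Y) X fst.
Proof.
have oTY := fs_setT hY.
move=> V oV.
have oV' : @opn (prod_space X Y) (fst @^-1` V).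
  move=> p Vp; exists V, setT, (fun=> 1); split=> //; last exact: oner_neq0.
  exact: tensor_const.
split=> // h rh p Vp; exists (fst @^-1` V), V, setT, (fun q => h q.1), (fun=> 1).
split=> //; last by move=> q _; rewrite oner_neq0 divr1.
split; last exact: tensor_const.
have := tensor_pure rh (fs_const hY 1 oTY).
by congr tensor_fun; apply: funext => q; rewrite mulr1.
Qed.

Lemma prod_snd : @morphism (prod_space X Y) Y snd.
Proof.
have oTX := fs_setT hX.
move=> V oV.
have oV' : @opn (prod_space X Y) (snd @^-1` V).
  move=> p Vp; exists setT, V, (fun=> 1); split=> //; last exact: oner_neq0.
  exact: tensor_const.
split=> // h rh p Vp; exists (snd @^-1` V), setT, V, (fun q => h q.2), (fun=> 1).
split=> //; last by move=> q _; rewrite oner_neq0 divr1.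
split; last exact: tensor_const.
have := tensor_pure (fs_const hX 1 oTX) rh.
by congr tensor_fun; apply: funext => q; rewrite mul1r.
Qed.

Lemma prod_pair (Z : space) (f : Z -> X) (g : Z -> Y) : is_fspace Z ->
  morphism f -> morphism g -> @morphism Z (prod_space X Y) (fun z => (f z, g z)).
Proof.
move=> hZ hf hg; pose h z := (f z, g z).
have pull (U : set X) (V : set Y) F : opn U -> opn V -> tensor_fun U V F ->
    opn (f @^-1` U `&` g @^-1` V) /\
    reg (f @^-1` U `&` g @^-1` V) (fun z => F (h z)).
  move=> oU oV [N [a [b [ra rb FE]]]].
  have [ofU rfU] := hf U oU; have [ogV rgV] := hg V oV.
  have oI := fs_setI hZ ofU ogV; split=> //.
  have ri i : reg (f @^-1` U `&` g @^-1` V) (fun z => a i (f z) * b i (g z)).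
    apply: fs_mul => //; [apply: fs_restr (rfU _ (ra i))
                         |apply: fs_restr (rgV _ (rb i))] => //.
  by apply: fs_ext (reg_sum hZ oI ri) => // z _; rewrite FE.
have oh (W : set (X * Y)) : prod_open W -> opn (h @^-1` W).
  move=> oW; apply: opn_loc => // z Wz.
  have [U [V [F [[oU oV] [Up Vp] tF Fp sF]]]] := oW _ Wz.
  have [oI rF] := pull _ _ _ oU oV tF; have [oD _] := fs_inv hZ oI rF.
  by eexists; split; [exact: oD|split|move=> y [[Uy Vy] Fy]; exact: sF].
move=> W oW; split; first exact: oh.
move=> s rs; apply: reg_loc => // z Wz.
have [W' [U [V [F [G [[oW' W'p] sW' [oU oV sUV] [tF tG] fE]]]]]] := rs _ Wz.
have [oI rF] := pull _ _ _ oU oV tF; have [_ rG] := pull _ _ _ oU oV tG.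
have oW'h := oh _ oW'; exists (h @^-1` W'); split=> //.
  by move=> y; exact: sW'.
have sI : h @^-1` W' `<=` f @^-1` U `&` g @^-1` V by move=> y /sUV.
have {}rF := fs_restr hZ oI oW'h sI rF; have {}rG := fs_restr hZ oI oW'h sI rG.
have [_ rV] := fs_inv hZ oW'h rG.
have WE : h @^-1` W' `&` [set y | G (h y) != 0] = h @^-1` W'.
  by apply/seteqP; split=> [y []//|y Wy]; split=> //; exact: (fE _ Wy).1.
rewrite WE in rV; apply: fs_ext (fs_mul hZ oW'h rF rV) => // y Wy.
by have [_ ->] := fE _ Wy.
Qed.

End ProductTheory.

Lemma prod_chart_affine (X Y : space) (U : set X) (V : set Y) :
  is_fspace X -> is_fspace Y ->
  is_affine (subspace_of U) -> is_affine (subspace_of V) ->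
  is_affine (@subspace_of (prod_space X Y) [set p | U p.1 /\ V p.2]).
Proof.
move=> hX hY [n [S [f [f' [mf mf' fK f'K]]]]] [m [T [g [g' [mg mg' gK g'K]]]]].
pose A : set (prod_space X Y) := [set p | U p.1 /\ V p.2].
pose R : set {mpoly k[n + m]} := [set p | forall (x : aff S) (y : aff T),
  peval (row_mx (sval x) (sval y)) p = 0].
have hXY := prod_fspace hX hY; have hA := @sub_fspace _ A hXY.
have hU := @sub_fspace _ U hX; have hV := @sub_fspace _ V hY.
have hS := aff_fspace S; have hT := aff_fspace T; have hR := aff_fspace R.
have lift_l (p : {mpoly k[n]}) (r : 'rV[k]_(n + m)) :
    peval (lsubmx r) p = peval r (p \mPo [tuple 'X_(lshift m i) | i < n]).
  rewrite /peval comp_mpoly_meval; apply: meval_eq => i.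
  by rewrite !tnth_mktuple mevalXU mxE.
have lift_r (p : {mpoly k[m]}) (r : 'rV[k]_(n + m)) :
    peval (rsubmx r) p = peval r (p \mPo [tuple 'X_(rshift n i) | i < m]).
  rewrite /peval comp_mpoly_meval; apply: meval_eq => i.
  by rewrite !tnth_mktuple mevalXU mxE.
have lR r : zero_set R r -> zero_set S (lsubmx r).
  move=> Rr s Ss; rewrite lift_l; apply: Rr => x y.
  by rewrite -lift_l row_mxKl; exact: (svalP x).
have rR r : zero_set R r -> zero_set T (rsubmx r).
  move=> Rr s Ts; rewrite lift_r; apply: Rr => x y.
  by rewrite -lift_r row_mxKr; exact: (svalP y).
pose pl (r : aff R) : aff S := exist _ (lsubmx (sval r)) (lR _ (svalP r)).
pose pr (r : aff R) : aff T := exist _ (rsubmx (sval r)) (rR _ (svalP r)).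
have mpl : morphism pl.
  apply: aff_lift => // i; apply: fs_ext (@aff_coord _ R (lshift m i)) => //.
    exact: fs_setT.
  by move=> r _; rewrite /= mxE.
have mpr : morphism pr.
  apply: aff_lift => // i; apply: fs_ext (@aff_coord _ R (rshift n i)) => //.
    exact: fs_setT.
  by move=> r _; rewrite /= mxE.
pose jl (p : subspace_of A) : subspace_of U := exist _ (sval p).1 (svalP p).1.
pose jr (p : subspace_of A) : subspace_of V := exist _ (sval p).2 (svalP p).2.
have mjl : morphism jl.
  by apply: sub_lift => //; apply: morphism_comp (@sub_incl _ A) (prod_fst hX hY).
have mjr : morphism jr.
  by apply: sub_lift => //; apply: morphism_comp (@sub_incl _ A) (prod_snd hX hY).
have zR (x : aff S) (y : aff T) : zero_set R (row_mx (sval x) (sval y)).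
  by move=> p; apply.
pose th (p : subspace_of A) : aff R := exist _ _ (zR (f (jl p)) (g (jr p))).
have inA (r : aff R) : A (sval (f' (pl r)), sval (g' (pr r))).
  by split; exact: svalP.
pose th' (r : aff R) : subspace_of A := exist _ _ (inA r).
exists (n + m)%N, R, th, th'; split.
- apply: aff_lift => // i.
  have oA := fs_setT hA.
  have rl j : reg setT (fun p => sval (f (jl p)) ord0 j).
    exact: (morphism_comp mjl mf (fs_setT hS)).2 _ (@aff_coord _ S j).
  have rr j : reg setT (fun p => sval (g (jr p)) ord0 j).
    exact: (morphism_comp mjr mg (fs_setT hT)).2 _ (@aff_coord _ T j).
  case: (splitP i) => j ij.
    have -> : i = lshift m j by exact: val_inj.
    by apply: fs_ext (rl j) => // p _; rewrite /= row_mxEl.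
  have -> : i = rshift n j by exact: val_inj.
  by apply: fs_ext (rr j) => // p _; rewrite /= row_mxEr.
- apply: sub_lift => //; apply: prod_pair => //.
    exact: morphism_comp (morphism_comp mpl mf') (@sub_incl _ U).
  exact: morphism_comp (morphism_comp mpr mg') (@sub_incl _ V).
- move=> p; apply: sval_inj => /=.
  have -> : pl (th p) = f (jl p) by apply: sval_inj; rewrite /= row_mxKl.
  have -> : pr (th p) = g (jr p) by apply: sval_inj; rewrite /= row_mxKr.
  by rewrite fK gK -surjective_pairing.
- move=> r; apply: sval_inj => /=.
  have -> : jl (th' r) = f' (pl r) by exact: sval_inj.
  have -> : jr (th' r) = g' (pr r) by exact: sval_inj.
  by rewrite f'K g'K /= hsubmxK.
Qed.

Lemma prod_prevariety (X Y : space) : is_prevariety X -> is_prevariety Y ->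
  is_prevariety (prod_space X Y).
Proof.
move=> [hX [I [U [oU cU aU]]]] [hY [J [V [oV cV aV]]]].
have hXY := prod_fspace hX hY; split=> //.
exists (I * J)%type, (fun ij => [set p | U ij.1 p.1 /\ V ij.2 p.2]); split.
- move=> [i j]; apply: (fs_setI hXY).
    exact: (prod_fst hX hY (oU i)).1.
  exact: (prod_snd hX hY (oV j)).1.
- by move=> [x y]; have [i Ui] := cU x; have [j Vj] := cV y; exists (i, j).
- by move=> [i j]; exact: prod_chart_affine.
Qed.

Lemma prod_separated (X Y : variety) : is_separated (prod_space X Y).
Proof.
have [hX _] := variety_prevariety X; have [hY _] := variety_prevariety Y.
move=> Z f g pZ mf mg; have hZ := pZ.1.
have o1 := variety_separated pZ (morphism_comp mf (prod_fst hX hY))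
             (morphism_comp mg (prod_fst hX hY)).
have o2 := variety_separated pZ (morphism_comp mf (prod_snd hX hY))
             (morphism_comp mg (prod_snd hX hY)).
apply: opn_loc => // z /= fgz.
have [e1|n1] := pselect ((f z).1 = (g z).1).
  have n2 : (f z).2 <> (g z).2.
    by move=> e2; apply: fgz; case: (f z) (g z) e1 e2 => a b [c d] /= -> ->.
  by eexists; split; [exact: o2| |move=> y /= + E; rewrite E].
by eexists; split; [exact: o1| |move=> y /= + E; rewrite E].
Qed.

Definition prod_variety (X Y : variety) : variety :=
  Variety (prod_prevariety (variety_prevariety X) (variety_prevariety Y))
          (@prod_separated X Y).

(* The universal property of the product among varieties. *)
Lemma prod_varietyP (X Y : variety) :
  [/\ @morphism (prod_variety X Y) X fst, @morphism (prod_variety X Y) Y snd &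
      forall (Z : variety) (f : Z -> X) (g : Z -> Y),
        morphism f -> morphism g ->
        @morphism Z (prod_variety X Y) (fun z => (f z, g z))].
Proof.
have [hX _] := variety_prevariety X; have [hY _] := variety_prevariety Y.
split; [exact: prod_fst|exact: prod_snd|move=> Z f g mf mg].
by apply: prod_pair => //; case: (variety_prevariety Z).
Qed.

(* The Grothendieck ring of varieties, by generators and relations: [K0] is   *)
(* the set of group terms in the generators [X], and [K0eq] is equality in    *)
(* K_0(Var_k), i.e. the least congruence that makes K0 an abelian group in    *)
(* which isomorphic varieties have the same class and [X] = [Y] + [X \ Y] for *)
(* Y closed in X.  K0 is kept as a setoid, since K_0(Var_k) lives one         *)
(* universe above k.                                                          *)
Inductive K0 : Type :=
  | K0class of variety
  | K0zero
  | K0opp of K0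
  | K0add of K0 & K0.

Inductive K0eq : K0 -> K0 -> Prop :=
  | K0eq_refl a : K0eq a a
  | K0eq_sym a b : K0eq a b -> K0eq b a
  | K0eq_trans b a c : K0eq a b -> K0eq b c -> K0eq a c
  | K0eq_add a a' b b' : K0eq a a' -> K0eq b b' -> K0eq (K0add a b) (K0add a' b')
  | K0eq_opp a a' : K0eq a a' -> K0eq (K0opp a) (K0opp a')
  | K0eq_addA a b c : K0eq (K0add a (K0add b c)) (K0add (K0add a b) c)
  | K0eq_addC a b : K0eq (K0add a b) (K0add b a)
  | K0eq_add0 a : K0eq (K0add K0zero a) a
  | K0eq_addN a : K0eq (K0add (K0opp a) a) K0zero
  | K0eq_iso (X Y : variety) :
      isomorphic X Y -> K0eq (K0class X) (K0class Y)
  | K0eq_scissor (X Y U : variety) (A : set X) :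
      opn (~` A) -> isomorphic Y (subspace_of A) ->
      isomorphic U (subspace_of (~` A)) ->
      K0eq (K0class X) (K0add (K0class Y) (K0class U)).

(* The product is the biadditive extension of [X] . [Y] = [X x Y]. *)
Fixpoint K0scale (X : variety) (b : K0) : K0 :=
  match b with
  | K0class Y => K0class (prod_variety X Y)
  | K0zero => K0zero
  | K0opp b => K0opp (K0scale X b)
  | K0add b c => K0add (K0scale X b) (K0scale X c)
  end.

Fixpoint K0mul (a b : K0) : K0 :=
  match a with
  | K0class X => K0scale X b
  | K0zero => K0zero
  | K0opp a => K0opp (K0mul a b)
  | K0add a c => K0add (K0mul a b) (K0mul c b)
  end.

Definition affine_space (n : nat) : variety := @aff_variety n set0.

Definition K0one : K0 := K0class (affine_space 0).

Definition K0L : K0 := K0class (affine_space 1).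

(* a - b lies in the ideal (L); the ring is commutative, so (L) = L . K0.     *)
Definition K0eq_modL (a b : K0) : Prop :=
  exists c : K0, K0eq (K0add a (K0opp b)) (K0mul K0L c).

End Spaces.

Arguments K0zero {k}.
Arguments K0one {k}.
Arguments K0L {k}.

(* A finite graph, with loops and multiple edges allowed; the order of the    *)
(* two ends of an edge is irrelevant.                                         *)
Record graph := Graph {
  vertex : finType;
  edge : finType;
  ends : edge -> vertex * vertex }.

Section Potts.
Variable G : graph.

(* Adjacency in the spanning subgraph of G with edge set A. *)
Definition adjacent (A : {set edge G}) : rel (vertex G) :=
  [rel x y | [exists e in A, (ends e == (x, y)) || (ends e == (y, x))]].

Definition num_components (A : {set edge G}) : nat :=
  n_comp (adjacent A) predT.

Variable k : closedFieldType.

(* Z_G(q, t), with the coordinate t_e numbered by [enum_rank e]. *)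
Definition potts (q : k) : {mpoly k[#|edge G|]} :=
  \sum_(A : {set edge G})
     q ^+ num_components A *: \prod_(e in A) 'X_(enum_rank e).

Definition potts_hypersurface (q : k) : variety k :=
  aff_variety [set potts q].

End Potts.

(* Main.v *)
(* Z_G is affine in each variable and the coefficient of the product of all   *)
(* the t_e is a power of q, hence nonzero; nothing else about the graph is    *)
(* used.  Write such a polynomial as f = t h + g, with g, h free of t.  The   *)
(* part h != 0 of (f = 0) is a graph over (h != 0), and the part h = 0 is a   *)
(* cylinder A^1 x (g = h = 0), so [f = 0] + [h = 0] = [A^m] mod L, where the  *)
(* last two classes live in the space of the remaining m variables.  As       *)
(* [A^m] = 0 mod L for m > 0, each step changes the sign, down to a nonzero   *)
(* constant h on a point.                                                     *)
(* All the steps stay inside the same A^n: the polynomials obtained after     *)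
(* eliminating the variables in B are considered on the subspace t_B = 0.     *)

Require Import Defs.
From mathcomp Require Import all_boot all_algebra.
From mathcomp Require Import mpoly.
From mathcomp Require Import boolp classical_sets.
From Stdlib Require Import Setoid Morphisms.
Import Defs.

Set Implicit Arguments.
Unset Strict Implicit.
Unset Printing Implicit Defensive.

Import GRing.Theory.
Local Open Scope ring_scope.

(** For $B\subseteq E$ let $f_B=\sum_{A\supseteq B}c(A)\prod_{e\in A\setminus B}t_e$, considered on
    the subspace $t_B=0$. Writing $f_B=t_e f_{B\cup e}+g$ with $e\notin B$, [K0eq_graph] compares
    $f_B=0$ with the hyperplane $t_e=0$ of that subspace: the loci $f_{B\cup e}\ne 0$ are
    isomorphic, and the rest of $f_B=0$ is a cylinder, hence a multiple of $\mathbb{L}$. So modulo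
    $\mathbb{L}$ the classes of $f_B$ and $f_{B\cup e}$ add up to that of an affine space
    ([K0class_multiaffine_step]), which is $0$ except for the final point. [K0class_multiaffine]
    iterates this, with $f_\emptyset=Z_G$ and $f_E=c(E)\neq 0$. *)

(** * Isomorphisms between affine algebraic sets *)

Section Isomorphisms.
Local Open Scope classical_set_scope.
Variable k : closedFieldType.
Implicit Types X Y Z : space k.

Lemma isomorphic_sym X Y : isomorphic X Y -> isomorphic Y X.
Proof. by move=> [f [g [mf mg fK gK]]]; exists g, f. Qed.

Lemma isomorphic_trans Y X Z :
  isomorphic X Y -> isomorphic Y Z -> isomorphic X Z.
Proof.
move=> [f [g [mf mg fK gK]]] [f' [g' [mf' mg' fK' gK']]].
exists (fun x => f' (f x)), (fun z => g (g' z)); split.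
- exact: morphism_comp mf mf'.
- exact: morphism_comp mg' mg.
- exact: can_comp fK' fK.
- exact: can_comp gK gK'.
Qed.

Lemma morphism_coord Z n (S : set {mpoly k[n]}) (f : Z -> aff S) i :
  morphism f -> reg setT (fun z => sval (f z) ord0 i).
Proof.
by move=> mf; exact: (mf _ (fs_setT (aff_fspace S))).2 _ (@aff_coord _ _ S i).
Qed.

Lemma reg_morphism_peval Z n (S : set {mpoly k[n]}) (f : Z -> aff S) p :
  is_fspace Z -> morphism f -> reg setT (fun z => peval (sval (f z)) p).
Proof.
move=> hZ mf; apply: reg_peval => // [|i]; first exact: fs_setT.
exact: morphism_coord.
Qed.

Lemma reg_inv Z (u : Z -> k) : is_fspace Z -> reg setT u ->
  (forall z, u z != 0) -> reg setT (fun z => (u z)^-1).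
Proof.
move=> hZ ru u0; have [_] := fs_inv hZ (fs_setT hZ) ru.
by rewrite setTI; congr reg; apply/seteqP; split=> // z _; exact: u0.
Qed.

Lemma zero_setU1 n (p : {mpoly k[n]}) (S : set {mpoly k[n]}) x :
  zero_set (p |` S) x <-> peval x p = 0 /\ zero_set S x.
Proof.
split=> [Sx|[px Sx] q [->|/Sx]//].
by split=> [|q Sq]; apply: Sx; [left|right].
Qed.

(** The scissor relation speaks of subspaces, whereas the elimination works with equations; this
    lemma passes from one to the other. Both maps keep the coordinates. *)
Lemma closed_subspace_iso n (S : set {mpoly k[n]}) p :
  isomorphic (aff (p |` S))
    (subspace_of [set x : aff S | peval (sval x) p = 0]).
Proof.
set A := [set x : aff S | _].
have hA := @sub_fspace _ _ A (aff_fspace S).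
have S1 x : zero_set (p |` S) x -> zero_set S x by move=> /zero_setU1[].
have S2 (y : subspace_of A) : zero_set (p |` S) (sval (sval y)).
  by apply/zero_setU1; split; [exact: svalP y|exact: svalP (sval y)].
pose u (x : aff (p |` S)) : aff S := exist _ _ (S1 _ (svalP x)).
have uA x : A (u x) by have /zero_setU1[] := svalP x.
exists (fun x => exist _ (u x) (uA x)), (fun y => exist _ _ (S2 y)); split.
- apply: sub_lift => /=; [exact: aff_fspace|exact: aff_fspace|].
  apply: aff_lift => [|i /=]; first exact: aff_fspace.
  exact: aff_coord.
- apply: aff_lift => //= i.
  exact: (morphism_coord i (@sub_incl _ (aff S) A)).
- by move=> x; exact: sval_inj.
- by move=> y; do 2!apply: sval_inj.
Qed.

(* Rabinowitsch's trick: the basic open set is the graph of 1 / p. *)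
Lemma basic_open_affine n (S : set {mpoly k[n]}) p :
  is_affine (subspace_of (~` [set x : aff S | peval (sval x) p = 0])).
Proof.
set A := ~` _; have hA := @sub_fspace _ _ A (aff_fspace S).
(* [w] reads a polynomial in the first $n$ of $n+1$ variables; the last variable will be $1/p$. *)
pose w (q : {mpoly k[n]}) : {mpoly k[n + 1]} :=
  q \mPo [tuple 'X_(lshift 1 i) | i < n].
have wE q r : peval r (w q) = peval (lsubmx r) q.
  rewrite /peval comp_mpoly_meval; apply: meval_eq => i.
  by rewrite !tnth_mktuple mevalXU mxE.
pose R : set {mpoly k[n + 1]} := ('X_(rshift n ord0) * w p - 1) |` (w @` S).
have R1 r : zero_set R r ->
    zero_set S (lsubmx r) /\ r ord0 (rshift n ord0) * peval (lsubmx r) p = 1.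
  move=> /zero_setU1[]; rewrite /peval mevalB mevalM mevalXU meval1 => /eqP.
  rewrite subr_eq0 -/(peval r (w p)) wE => /eqP-> Sr; split=> // q Sq.
  by rewrite -wE; apply: Sr; exists q.
pose rr (x : subspace_of A) : 'rV[k]_(n + 1) :=
  row_mx (sval (sval x)) (\row_(i < 1) (peval (sval (sval x)) p)^-1).
have A0 (x : subspace_of A) : peval (sval (sval x)) p != 0.
  by apply/eqP; exact: svalP x.
have R2 x : zero_set R (rr x).
  apply/zero_setU1; split; last first.
    by move=> _ [q Sq <-]; rewrite wE row_mxKl; exact: (svalP (sval x) q Sq).
  rewrite /peval mevalB mevalM mevalXU meval1 -/(peval _ (w p)) wE row_mxKl.
  by rewrite row_mxEr mxE mulVf ?subrr.
pose l (r : aff R) : aff S := exist _ _ (R1 _ (svalP r)).1.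
have lA r : A (l r).
  move=> /= l0; have [_ /eqP] := R1 _ (svalP r).
  by rewrite l0 mulr0 eq_sym oner_eq0.
exists (n + 1)%N, R, (fun x => exist _ _ (R2 x)), (fun r => exist _ (l r) (lA r)).
split.
- apply: aff_lift => //= i; have oA := fs_setT hA.
  have mA := @sub_incl _ (aff S) A.
  case: (splitP i) => j ij.
    have -> : i = lshift 1 j by exact: val_inj.
    by apply: fs_ext (morphism_coord j mA) => // x _; rewrite row_mxEl.
  have -> : i = rshift n j by exact: val_inj.
  have ri := reg_inv hA (reg_morphism_peval p hA mA) A0.
  by apply: fs_ext ri => // x _; rewrite row_mxEr mxE.
- have hR := aff_fspace R; apply: sub_lift => //; first exact: aff_fspace.
  apply: aff_lift => //= i; have oR := fs_setT hR.
  by apply: fs_ext (@aff_coord _ _ R (lshift 1 i)) => // r _; rewrite mxE.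
- by move=> x; do 2!apply: sval_inj; rewrite /= row_mxKl.
- move=> r; apply: sval_inj => /=; apply/rowP => i; rewrite /rr /=.
  case: (splitP i) => j ij.
    have -> : i = lshift 1 j by exact: val_inj.
    by rewrite row_mxEl mxE.
  have -> : i = rshift n j by exact: val_inj.
  rewrite row_mxEr mxE ord1; have [_ /= r1] := R1 _ (svalP r).
  have l0 := A0 (exist _ (l r) (lA r)).
  by apply: (mulIf l0); rewrite mulVf ?r1 //; exact: l0.
Qed.

(** With $s=0$ this is the projection onto the hyperplane $t_i=0$, which replaces dropping a
    coordinate and so avoids renumbering the variables. *)
Definition upd n (x : 'rV[k]_n) (i : 'I_n) (s : k) : 'rV[k]_n :=
  \row_j (if j == i then s else x ord0 j).

Lemma upd_upd n (x : 'rV[k]_n) i s t : upd (upd x i s) i t = upd x i t.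
Proof. by apply/rowP => j; rewrite !mxE; case: eqP. Qed.

Lemma upd_id n (x : 'rV[k]_n) i s : x ord0 i = s -> upd x i s = x.
Proof. by move=> <-; apply/rowP => j; rewrite !mxE; case: eqP => // ->. Qed.

Lemma upd_eq n (x : 'rV[k]_n) i s : upd x i s ord0 i = s.
Proof. by rewrite mxE eqxx. Qed.

Lemma reg_upd Z n (S : set {mpoly k[n]}) (f : Z -> aff S) (u : Z -> k) i j :
  is_fspace Z -> morphism f -> reg setT u ->
  reg setT (fun z => upd (sval (f z)) i (u z) ord0 j).
Proof.
move=> hZ mf ru; have oZ := fs_setT hZ; have [ji|ji] := eqVneq j i.
  by apply: fs_ext ru => // z _; rewrite mxE ji eqxx.
apply: fs_ext (morphism_coord j mf) => // z _.
by rewrite mxE (negPf ji).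
Qed.

(** The base [T] lies in the hyperplane $t_i=0$ and [S] is its preimage under projection, so $x$
    corresponds to the pair of $x_i$ and the projection of $x$. *)
Lemma cylinder_iso n (S T : set {mpoly k[n]}) i :
  (forall x, zero_set S x <-> zero_set T (upd x i 0)) ->
  (forall x, zero_set T x -> x ord0 i = 0) ->
  isomorphic (aff S) (prod_space (affine_space k 1) (aff T)).
Proof.
move=> ST Ti; pose L : space k := affine_space k 1.
have hS := aff_fspace S; have hT := aff_fspace T.
have hL : is_fspace L := aff_fspace _.
have hP := prod_fspace hL hT.
have zL (s : 'rV[k]_1) : zero_set set0 s by [].
pose a (x : aff S) : L := exist _ (\row_(j < 1) sval x ord0 i) (zL _).
pose b (x : aff S) : aff T := exist _ _ ((ST _).1 (svalP x)).
have cS (p : prod_space L (aff T)) :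
    zero_set S (upd (sval p.2) i (sval p.1 ord0 ord0)).
  by apply/ST; rewrite upd_upd upd_id; [exact: svalP p.2|apply/Ti/(svalP p.2)].
have mid : @morphism _ (aff S) (aff S) id by move=> V oV; split.
have oS := fs_setT hS.
exists (fun x => (a x, b x)), (fun p => exist _ _ (cS p)); split.
- apply: prod_pair => //; apply: aff_lift => // j /=.
    by apply: fs_ext (@aff_coord _ _ S i) => // x _; rewrite mxE.
  exact: (@reg_upd _ _ _ _ (fun=> 0) i j hS mid (fs_const hS 0 oS)).
- apply: aff_lift => //= j; apply: (@reg_upd (prod_space L (aff T)) _ _ snd) => //.
    exact: prod_snd.
  exact: (@morphism_coord (prod_space L (aff T)) _ _ fst _ (prod_fst hL hT)).
- by move=> x; apply: sval_inj; rewrite /= upd_upd mxE upd_id.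
- move=> [s x]; congr (_, _); apply: sval_inj => /=.
    by apply/rowP => j; rewrite !mxE eqxx !ord1.
  by rewrite upd_upd upd_id //; apply/Ti/(svalP x).
Qed.

(** Independence of $t_i$ is expressed by values, since only zero sets matter below. *)
Definition free_of {n} (i : 'I_n) (p : {mpoly k[n]}) : Prop :=
  forall x s, peval (upd x i s) p = peval x p.

(* Where h != 0, the equation t_i h + g = 0 is solved by t_i = - g / h. *)
Lemma graph_iso n (S : set {mpoly k[n]}) i f g h :
  (forall p, S p -> free_of i p) -> free_of i g -> free_of i h ->
  f = 'X_i * h + g ->
  isomorphic
    (subspace_of (~` [set x : aff (f |` S) | peval (sval x) h = 0]))
    (subspace_of (~` [set x : aff ('X_i |` S) | peval (sval x) h = 0])).
Proof.
move=> Si gi hi fE; set A := ~` _; set B := ~` _.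
have fP x : peval x f = x ord0 i * peval x h + peval x g.
  by rewrite fE /peval mevalD mevalM mevalXU.
have SU x s : zero_set S x -> zero_set S (upd x i s).
  by move=> Sx p Sp; rewrite Si // Sx.
have hF := aff_fspace (f |` S); have hX := aff_fspace ('X_i |` S).
have hA := @sub_fspace _ _ A hF; have hB := @sub_fspace _ _ B hX.
have B0 (y : subspace_of B) : peval (sval (sval y)) h != 0.
  by apply/eqP; exact: svalP y.
(* The forward map forgets $t_i$; the equations in [S] survive because they do not involve it. *)
have uP (x : aff (f |` S)) : zero_set ('X_i |` S) (upd (sval x) i 0).
  have /zero_setU1[_ Sx] := svalP x; apply/zero_setU1; split; last exact: SU.
  by rewrite /peval mevalXU upd_eq.
pose u x : aff ('X_i |` S) := exist _ _ (uP x).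
have uB (x : subspace_of A) : B (u (sval x)).
  by rewrite /B /= hi; exact: svalP x.
pose t (y : 'rV[k]_n) := - peval y g / peval y h.
have vP (y : subspace_of B) :
    zero_set (f |` S) (upd (sval (sval y)) i (t (sval (sval y)))).
  have /zero_setU1[_ Sy] := svalP (sval y); apply/zero_setU1; split; last exact: SU.
  by rewrite fP upd_eq hi gi /t divfK // addNr.
pose v y : aff (f |` S) := exist _ _ (vP y).
have vA (y : subspace_of B) : A (v y) by rewrite /A /= hi; exact: svalP y.
have mA := @sub_incl _ (aff (f |` S)) A.
have mB := @sub_incl _ (aff ('X_i |` S)) B.
have oA := fs_setT hA; have oB := fs_setT hB.
exists (fun x => exist _ _ (uB x)), (fun y => exist _ _ (vA y)); split.
- apply: sub_lift => //; apply: aff_lift => //= j.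
  exact: (@reg_upd _ _ _ _ (fun=> 0) i j hA mA (fs_const hA 0 oA)).
- apply: sub_lift => //; apply: aff_lift => //= j.
  apply: (@reg_upd _ _ _ _ (fun y : subspace_of B => t (sval (sval y))) i j hB mB).
  have rg := reg_morphism_peval g hB mB.
  have rh := reg_inv hB (reg_morphism_peval h hB mB) B0.
  have rN := fs_mul hB oB (fs_const hB (-1) oB) rg.
  by apply: fs_ext (fs_mul hB oB rN rh) => // y _; rewrite mulN1r.
- move=> x; do 2!apply: sval_inj; rewrite /= upd_upd upd_id // /t gi hi.
  have /zero_setU1[/eqP + _] := svalP (sval x).
  rewrite fP addr_eq0 => /eqP <-; rewrite mulfK //.
  by apply/eqP; exact: svalP x.
- move=> y; do 2!apply: sval_inj; rewrite /= upd_upd upd_id //.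
  by have /zero_setU1[] := svalP (sval y); rewrite /peval mevalXU.
Qed.

End Isomorphisms.

(** * Group calculus in the setoid [K0], and congruence modulo $\mathbb{L}$ *)

#[export] Instance K0eq_equiv (k : closedFieldType) : Equivalence (@K0eq k).
Proof.
split; [exact: K0eq_refl|exact: K0eq_sym|].
by move=> a b c; exact: K0eq_trans.
Qed.

#[export] Instance K0add_proper (k : closedFieldType) :
  Proper (@K0eq k ==> @K0eq k ==> @K0eq k) (@K0add k).
Proof. by move=> a a' aa' b b' bb'; exact: K0eq_add. Qed.

#[export] Instance K0opp_proper (k : closedFieldType) :
  Proper (@K0eq k ==> @K0eq k) (@K0opp k).
Proof. by move=> a a' aa'; exact: K0eq_opp. Qed.

Local Notation "a =K b" := (K0eq a b) (at level 70).
Local Notation "a =L b" := (K0eq_modL a b) (at level 70).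

Section K0Group.
Variable k : closedFieldType.
Implicit Types a b c d : K0 k.

Lemma K0subrr a : K0add a (K0opp a) =K K0zero.
Proof. by rewrite -> (K0eq_addC a); exact: K0eq_addN. Qed.

Lemma K0addr0 a : K0add a K0zero =K a.
Proof. by rewrite -> (K0eq_addC a); exact: K0eq_add0. Qed.

Lemma K0addACA a b c d :
  K0add (K0add a b) (K0add c d) =K K0add (K0add a c) (K0add b d).
Proof.
rewrite <- (K0eq_addA a b), -> (K0eq_addA b c), -> (K0eq_addC b c).
rewrite <- (K0eq_addA c b), -> (K0eq_addA a c); reflexivity.
Qed.

Lemma K0addrK a b : K0add (K0add a b) (K0opp b) =K a.
Proof. by rewrite <- K0eq_addA, -> K0subrr; exact: K0addr0. Qed.

Lemma K0add_eq0 a b : K0add a b =K K0zero -> a =K K0opp b.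
Proof.
by move=> ab; rewrite <- (K0addrK a b), -> ab; exact: K0eq_add0.
Qed.

Lemma K0oppK a : K0opp (K0opp a) =K a.
Proof. by symmetry; apply: K0add_eq0; exact: K0subrr. Qed.

Lemma K0oppD a b : K0opp (K0add a b) =K K0add (K0opp a) (K0opp b).
Proof.
symmetry; apply: K0add_eq0; rewrite -> K0addACA, -> !K0eq_addN.
exact: K0eq_add0.
Qed.

Lemma K0opp0 : K0opp K0zero =K (K0zero : K0 k).
Proof. by symmetry; apply: K0add_eq0; exact: K0eq_add0. Qed.

Lemma K0eq_modL_eq a b : a =K b -> a =L b.
Proof. by move=> ab; exists K0zero; rewrite -> ab; exact: K0subrr. Qed.

Lemma K0mulL_modL0 a : K0mul K0L a =L K0zero.
Proof. by exists a; rewrite -> K0opp0; exact: K0addr0. Qed.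

(** The multiples of $\mathbb{L}$ form a subgroup: [K0mul K0L] commutes with opposites and sums by
    mere computation, which the conversions below exploit. *)
#[export] Instance K0eq_modL_equiv : Equivalence (@K0eq_modL k).
Proof.
split.
- by move=> a; apply: K0eq_modL_eq; exact: K0eq_refl.
- move=> a b [c ac]; exists (K0opp c); rewrite -[K0mul _ _]/(K0opp (K0mul K0L c)).
  rewrite <- ac, -> K0oppD, -> K0oppK, -> K0eq_addC; reflexivity.
- move=> a b c [d abd] [e bce]; exists (K0add d e).
  rewrite -[K0mul _ _]/(K0add (K0mul K0L d) (K0mul K0L e)).
  rewrite <- abd, <- bce, -> (K0eq_addC b), -> K0addACA, -> K0eq_addN.
  rewrite -> K0addr0; reflexivity.
Qed.

#[export] Instance K0add_modL_proper :
  Proper (@K0eq_modL k ==> @K0eq_modL k ==> @K0eq_modL k) (@K0add k).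
Proof.
move=> a a' [c ac] b b' [d bd]; exists (K0add c d).
rewrite -[K0mul _ _]/(K0add (K0mul K0L c) (K0mul K0L d)).
rewrite <- ac, <- bd, -> K0oppD, -> K0addACA; reflexivity.
Qed.

#[export] Instance K0opp_modL_proper :
  Proper (@K0eq_modL k ==> @K0eq_modL k) (@K0opp k).
Proof.
move=> a a' [c ac]; exists (K0opp c); rewrite -[K0mul _ _]/(K0opp (K0mul K0L c)).
rewrite <- ac, -> K0oppD; reflexivity.
Qed.

Lemma K0add_eq0_modL a b : K0add a b =L K0zero -> a =L K0opp b.
Proof.
move=> ab; rewrite <- (K0eq_modL_eq (K0addrK a b)), -> ab.
exact/K0eq_modL_eq/K0eq_add0.
Qed.

(** An empty $X$ is isomorphic to both pieces of any decomposition of itself, so $[X]=[X]+[X]$. *)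
Lemma K0class_empty (X : variety k) : (X -> False) -> K0class X =K K0zero.
Proof.
move=> X0; have hX := (variety_prevariety X).1.
have oT := fs_setT hX.
have iX (A : set X) : isomorphic X (subspace_of A).
  have F (T : Type) (x : X) : T by case: (X0 x).
  exists (fun x => F _ x), (fun y => sval y); split.
  - move=> V oV.
    have E (U : set X) : U = setT by apply/seteqP; split=> x; case: (X0 x).
    rewrite (E (_ @^-1` V)%classic); split=> // h rh.
    by apply: fs_ext (fs_const hX 0 oT) => // x; case: (X0 x).
  - exact: sub_incl.
  - by move=> x; case: (X0 x).
  - by move=> y; case: (X0 (sval y)).
have oA : opn (~` (@setT X))%classic.
  have -> : (~` @setT X = setT)%classic by apply/seteqP; split=> x; case: (X0 x).
  exact: oT.
have XX := K0eq_scissor oA (iX _) (iX _).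
rewrite <- (K0addrK (K0class X) (K0class X)), <- XX; exact: K0subrr.
Qed.

End K0Group.

(** * Scissor relations for one variable, then elimination of all variables *)

Section Multiaffine.
Local Open Scope classical_set_scope.
Variable k : closedFieldType.

(** [R] is any variety modelling the locus $p\ne 0$, because classes are defined for varieties and
    not for bare subspaces. *)
Lemma K0eq_basic_open n (S : set {mpoly k[n]}) p (R : variety k) :
  isomorphic R (subspace_of (~` [set x : aff S | peval (sval x) p = 0])) ->
  K0class (aff_variety S) =K K0add (K0class (aff_variety (p |` S))) (K0class R).
Proof.
move=> iR; apply: (@K0eq_scissor _ (aff_variety S) _ _ _ _ _ iR).
  rewrite [X in opn X](_ : _ = [set x : aff S | peval (sval x) p != 0]).
    exact: aff_opnD.
  by apply/seteqP; split=> x /eqP.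
exact: closed_subspace_iso.
Qed.

Lemma K0eq_cylinder n (S T : set {mpoly k[n]}) i :
  (forall x, zero_set S x <-> zero_set T (upd x i 0)) ->
  (forall x, zero_set T x -> x ord0 i = 0) ->
  K0class (aff_variety S) =K K0mul K0L (K0class (aff_variety T)).
Proof. by move=> ST Ti; apply: K0eq_iso; exact: cylinder_iso ST Ti. Qed.

Lemma zero_set_upd n (S : set {mpoly k[n]}) i x s :
  (forall p, S p -> free_of i p) -> zero_set S (upd x i s) <-> zero_set S x.
Proof. by move=> Si; split=> Sx p Sp; move: (Sx p Sp); rewrite Si. Qed.

(* Both differences [f = 0] - [f = h = 0] and [t_i = 0] - [t_i = h = 0] are    *)
(* the class of the locus h != 0 (graph_iso).                                 *)
Lemma K0eq_graph n (S : set {mpoly k[n]}) i f g h :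
  (forall p, S p -> free_of i p) -> free_of i g -> free_of i h ->
  f = 'X_i * h + g ->
  K0add (K0class (aff_variety (f |` S)))
        (K0class (aff_variety (h |` ('X_i |` S)))) =K
  K0add (K0class (aff_variety ('X_i |` S)))
        (K0mul K0L (K0class (aff_variety (h |` (g |` ('X_i |` S)))))).
Proof.
move=> Si gi hi fE.
(* One affine model [R] of the locus $h\ne 0$ serves in both decompositions. *)
have [m [R' iR]] := basic_open_affine ('X_i |` S) h.
pose R := aff_variety R'; have {}iR := isomorphic_sym iR : isomorphic R _.
rewrite -> (K0eq_basic_open iR).
have /K0eq_basic_open eR := isomorphic_trans iR (isomorphic_sym (graph_iso Si gi hi fE)).
rewrite -> eR.
(* Where $h=0$, the equation $f=0$ reduces to $g=0$ and leaves $t_i$ free. *)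
have -> : K0class (aff_variety (h |` (f |` S))) =K
    K0mul K0L (K0class (aff_variety (h |` (g |` ('X_i |` S))))).
  apply: (@K0eq_cylinder _ _ _ i) => [x|x].
    rewrite !zero_setU1 hi gi zero_set_upd // fE /peval mevalD mevalM !mevalXU.
    rewrite upd_eq -!/(peval _ _).
    by split=> [[-> [+ Sx]]|[-> [-> [_ Sx]]]]; rewrite mulr0 add0r.
  by rewrite !zero_setU1 => -[_ [_ [+ _]]]; rewrite /peval mevalXU.
rewrite <- K0eq_addA, -> K0eq_addC.
by rewrite -> (K0eq_addC (K0class R)); reflexivity.
Qed.

Variable E : finType.
Implicit Types (A B : {set E}) (c : {set E} -> k).

(** The coefficient of $\prod_{e\in B}t_e$ in $\sum_A c(A)\prod_{e\in A}t_e$, as a polynomial in the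
    variables outside [B]: the $h$ reached after eliminating the variables in [B]. *)
Definition multiaffine c B : {mpoly k[#|E|]} :=
  \sum_(A : {set E} | B \subset A)
     c A *: \prod_(e in A :\: B) 'X_(enum_rank e).

Definition coord_eqs B : set {mpoly k[#|E|]} :=
  [set p | exists2 e, e \in B & p = 'X_(enum_rank e)].

Lemma coord_eqsU1 e B : coord_eqs (e |: B) = 'X_(enum_rank e) |` coord_eqs B.
Proof.
apply/seteqP; split=> [_ [e' + ->]|p [->|[e' eB ->]]].
- by rewrite !inE => /orP[/eqP->|eB]; [left|right; exists e'].
- by exists e; rewrite ?setU11.
- by exists e'; rewrite // !inE eB orbT.
Qed.

Lemma coord_eqs_free e B p :
  e \notin B -> coord_eqs B p -> free_of (enum_rank e) p.
Proof.
move=> eB [e' e'B ->] x s; rewrite /peval !mevalXU mxE.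
by case: eqP => // /enum_rank_inj ee'; rewrite -ee' e'B in eB.
Qed.

Lemma free_of_sum e (P : pred {set E}) c (D : {set E} -> {set E}) :
  (forall A, P A -> e \notin D A) ->
  free_of (enum_rank e)
    (\sum_(A : {set E} | P A) c A *: \prod_(e' in D A) 'X_(enum_rank e')).
Proof.
move=> eD x s; rewrite /peval !raddf_sum /=; apply: eq_bigr => A PA.
rewrite !mevalZ !rmorph_prod /=; congr (_ * _); apply: eq_bigr => e' e'D.
rewrite !mevalXU mxE; case: eqP => // /enum_rank_inj ee'.
by have := eD A PA; rewrite -ee' e'D.
Qed.

(** Sort the sets $A\supseteq B$ by whether they contain $e$: those that do contribute the multiples
    of $t_e$. *)
Lemma multiaffine_split c B e : e \notin B ->
  multiaffine c B = 'X_(enum_rank e) * multiaffine c (e |: B)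
    + \sum_(A : {set E} | (B \subset A) && (e \notin A))
        c A *: \prod_(e' in A :\: B) 'X_(enum_rank e').
Proof.
move=> eB; rewrite /multiaffine (bigID (fun A : {set E} => e \in A)) /=.
congr (_ + _); rewrite mulr_sumr; apply: eq_big => [A|A /andP[_ eA]].
  by rewrite finset.subUset finset.sub1set andbC.
rewrite -scalerAr (bigD1 e) ?inE ?eA ?eB //=; congr (_ *: (_ * _)).
by apply: eq_bigl => e'; rewrite !inE; case: eqP; rewrite ?andbF ?andbT.
Qed.

(** The coordinate $t_e$ is still free, so the subspace is a line times a smaller one. *)
Lemma K0class_coord_eqs B e : e \notin B ->
  K0class (aff_variety (coord_eqs B)) =L K0zero.
Proof.
move=> eB; have Be := coord_eqs_free eB.
have cyl x : zero_set (coord_eqs B) x <->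
    zero_set (coord_eqs (e |: B)) (upd x (enum_rank e) 0).
  rewrite coord_eqsU1 zero_setU1 zero_set_upd //.
  by rewrite /peval mevalXU upd_eq; split=> [|[]].
have ze x : zero_set (coord_eqs (e |: B)) x -> x ord0 (enum_rank e) = 0.
  by rewrite coord_eqsU1 zero_setU1 => -[+ _]; rewrite /peval mevalXU.
rewrite -> (K0eq_modL_eq (K0eq_cylinder cyl ze)); exact: K0mulL_modL0.
Qed.

Lemma K0class_coord_eqs_full B : (forall e, e \in B) ->
  K0class (aff_variety (coord_eqs B)) =K K0one.
Proof.
move=> Bf; apply: K0eq_iso.
have hB := aff_fspace (coord_eqs B).
have h0 := aff_fspace (set0 : set {mpoly k[0]}).
have z0 (s : 'rV[k]_0) : zero_set set0 s by [].
have zB : zero_set (coord_eqs B) (0 : 'rV[k]_#|E|).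
  by move=> _ [e _ ->]; rewrite /peval mevalXU mxE.
exists (fun=> exist _ 0 (z0 0)), (fun=> exist _ 0 zB); split.
- by apply: aff_lift => // -[].
- apply: aff_lift => // i /=; apply: fs_ext (fs_const h0 0 (fs_setT h0)) => //.
    exact: fs_setT.
  by move=> x _; rewrite mxE.
- move=> x; apply: sval_inj; apply/rowP => i; rewrite /= mxE.
  have := svalP x 'X_i; rewrite /peval mevalXU => -> //.
  by exists (enum_val i); rewrite // enum_valK.
- by move=> x; apply: sval_inj; apply/rowP => -[].
Qed.

(** With no variable left the polynomial is the nonzero constant $c(B)$, so its zero set is
    empty. *)
Lemma K0class_multiaffine_full c B :
  (forall e, e \in B) -> c B != 0 ->
  K0class (aff_variety (multiaffine c B |` coord_eqs B)) =K K0zero.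
Proof.
move=> Bf cB; apply: K0class_empty => -[x /zero_setU1[+ _]].
have BT A : (B \subset A) = (A == B).
  apply/idP/eqP => [/fintype.subsetP BA|->//].
  by apply/setP => e; rewrite Bf BA.
rewrite /multiaffine (eq_bigl _ _ BT) big_pred1_eq /peval mevalZ.
rewrite big1 => [|e]; last by rewrite finset.setDv inE.
by rewrite meval1 mulr1; exact/eqP.
Qed.

(** This is [K0eq_graph] for $t_e$ over $t_B=0$, where the cylinder term dies modulo
    $\mathbb{L}$. *)
Lemma K0class_multiaffine_step c B e : e \notin B ->
  K0add (K0class (aff_variety (multiaffine c B |` coord_eqs B)))
        (K0class (aff_variety (multiaffine c (e |: B) |` coord_eqs (e |: B)))) =L
  K0class (aff_variety (coord_eqs (e |: B))).
Proof.
move=> eB; rewrite coord_eqsU1; have free := @free_of_sum e.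
have fD : free_of (enum_rank e) (multiaffine c (e |: B)).
  by apply: free => A _; rewrite !inE eqxx.
have fS : forall p, coord_eqs B p -> free_of (enum_rank e) p.
  by move=> p; exact: coord_eqs_free.
have fg : free_of (enum_rank e)
    (\sum_(A : {set E} | (B \subset A) && (e \notin A))
       c A *: \prod_(e' in A :\: B) 'X_(enum_rank e')).
  by apply: free => A /andP[_ eA]; rewrite inE (negPf eA) andbF.
rewrite -> (K0eq_modL_eq (K0eq_graph fS fg fD (multiaffine_split c eB))).
rewrite -> K0mulL_modL0, -> (K0eq_modL_eq (K0addr0 _)); reflexivity.
Qed.

Lemma K0class_multiaffine c B : c finset.setT != 0 -> (0 < #|~: B|)%N ->
  K0class (aff_variety (multiaffine c B |` coord_eqs B)) =L
  (if odd #|~: B| then K0one else K0opp K0one).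
Proof.
move=> cT.
have pick m B' : #|~: B'| = m.+1 ->
    exists2 e, e \notin B' & #|~: (e |: B')| = m.
  move=> Em; have /card_gt0P[e] : (0 < #|~: B'|)%N by rewrite Em.
  rewrite inE => eB; exists e => //; move: Em; rewrite (cardsD1 e) inE eB => -[<-].
  by rewrite finset.setDE -finset.setCU finset.setUC.
(* The number of remaining variables is $m+1$, so the induction starts at one variable. *)
case Em: #|~: B| => [|m] // _; elim: m B Em => [|m IHm] B /pick[e eB Em];
  have step := K0class_multiaffine_step c eB.
(* One variable: $h$ is the constant $c(E)\ne 0$ and the hyperplane is a point, which gives $1$. *)
- have full e' : e' \in e |: B.
    by apply/negPn; rewrite -finset.in_setC (cards0_eq Em) inE.
  have BT : e |: B = finset.setT by apply/setP => e'; rewrite full inE.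
  move: step; rewrite -> (K0eq_modL_eq (K0class_coord_eqs_full full)).
  have c0 : c (e |: B) != 0 by rewrite BT.
  rewrite -> (K0eq_modL_eq (K0class_multiaffine_full full c0)).
  by rewrite -> (K0eq_modL_eq (K0addr0 _)).
(* A second free variable $e'$ makes the hyperplane a multiple of $\mathbb{L}$, so eliminating $e$
   just changes the sign. *)
- have [e' e'B _] := pick _ _ Em; move: step; rewrite -> (K0class_coord_eqs e'B).
  move=> /K0add_eq0_modL ->; rewrite -> (IHm _ Em) => /=.
  by case: (odd m) => /=; [exact/K0eq_modL_eq/K0oppK|reflexivity].
Qed.

End Multiaffine.

Theorem mainTheorem7 (k : closedFieldType) (char0 : [pchar k] =i pred0)
    (G : graph) (q : k) (n_ge1 : (1 <= #|edge G|)%N) (q_neq0 : q != 0) :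
  (odd #|edge G| ->
     K0eq_modL (K0class (potts_hypersurface G q)) K0one) /\
  (~~ odd #|edge G| ->
     K0eq_modL (K0class (potts_hypersurface G q)) (K0opp K0one)).
Proof.
(* With these coefficients and [B] empty, [multiaffine] is the Potts polynomial and there are no
   coordinate equations. *)
pose c (A : {set edge G}) := q ^+ num_components A.
have cT : c finset.setT != 0 by rewrite expf_neq0.
have cE : #|~: (finset.set0 : {set edge G})| = #|edge G|.
  by rewrite finset.setC0 cardsT.
have pE : multiaffine c finset.set0 = potts G q.
  rewrite /potts /multiaffine.
  apply: eq_big => [A|A _]; first by rewrite finset.sub0set.
  by rewrite finset.setD0.
have eqs0 : @coord_eqs k _ (finset.set0 : {set edge G}) = set0%classic.
  by apply/seteqP; split=> [p [e]|//]; rewrite inE.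
have := @K0class_multiaffine _ _ c finset.set0 cT.
by rewrite cE pE eqs0 setU0 => /(_ n_ge1); case: odd.
Qed.
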